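(* Let $L$ be a loop of order $n$ with underlying set $I_n=\{1,2,\ldots,n\}$, whose product of $x$ and $y$ is written $xy$, and let $c$ be any non-identity element of $L$. Let $\Gamma_3$ be the digraph with vertex set $I_n\times I_n\times\mathbb{Z}_2$ whose darts (arcs) are exactly the following: \begin{itemize} \item $(x,y,i)\mapsto(z,y,i)$ for all $i\in\mathbb{Z}_2$, $x,y,z\in I_n$, $x\neq z$; \item $(x,y,i)\mapsto(x,z,i)$ for all $i\in\mathbb{Z}_2$, $x,y,z\in I_n$, $y\neq z$; \item $(x,y,0)\mapsto(xy,z,1)$ for all $x,y,z\in I_n$; \item $(x,y,1)\mapsto(z,yx,0)$ for all $x,y,z\in I_n$; \item $(x,y,0)\mapsto(c(xy),z,1)$ for all $x,y,z\in I_n$; \item $(x,y,1)\mapsto(z,(yx)c,0)$ for all $x,y,z\in I_n$. \end{itemize} Then $\Gamma_3$ is a directed strongly regular graph with parameter set $(2n^2,\,4n-2,\,2n+2,\,n+2,\,6)$.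
   Context: A quasigroup is a set $Q$ with a binary operation such that for all $a,b\in Q$ each of the equations $ax=b$ and $ya=b$ has a unique solution in $Q$. A loop is a quasigroup with an identity element $e$, i.e. $ex=xe=x$ for every $x$. Associativity is not assumed. A directed strongly regular graph (DSRG) with parameter set $(N,k,t,\lambda,\mu)$ (in this order) is a loopless directed graph on $N$ vertices that is regular of valency $k$ (every vertex has in-degree and out-degree $k$), such that every vertex is incident with exactly $t$ undirected edges (an undirected edge is a pair of opposite arcs), and for any two distinct vertices $x,y$ the number of directed paths of length 2 from $x$ to $y$ is $\lambda$ if there is an arc from $x$ to $y$ and $\mu$ otherwise. Equivalently, its adjacency matrix $A$ (with zero diagonal) satisfies $AJ=JA=kJ$ and $A^2=tI+\lambda A+\mu(J-I-A)$, where $J$ is the all-one matrix and $I$ the identity matrix. The case $t=k$ (an undirected strongly regular graph) is allowed in this definition. *)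

(* Defs.v *)
From HB Require Import structures.
From mathcomp Require Import all_boot all_order all_algebra.

Set Implicit Arguments.
Unset Strict Implicit.
Unset Printing Implicit Defensive.

Definition quasigroup (Q : Type) (mul : Q -> Q -> Q) : Prop :=
  forall a b : Q, (exists! x, mul a x = b) /\ (exists! y, mul y a = b).

Definition loop (Q : Type) (mul : Q -> Q -> Q) (e : Q) : Prop :=
  quasigroup mul /\ (forall x, mul e x = x /\ mul x e = x).

(* A digraph without multiple arcs is given by its arc relation. *)
Record dsrg (V : finType) (arc : rel V) (N k t lambda mu : nat) : Prop := Dsrg {
  dsrg_order : #|V| = N;
  dsrg_loopless : forall x, ~~ arc x x;
  dsrg_outdeg : forall x, #|[set y | arc x y]| = k;
  dsrg_indeg : forall x, #|[set y | arc y x]| = k;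
  dsrg_undirected : forall x, #|[set y | arc x y && arc y x]| = t;
  dsrg_paths2 : forall x y, x != y ->
    #|[set z | arc x z && arc z y]| = if arc x y then lambda else mu
}.

Definition gamma3 (n : nat) (mul : 'I_n -> 'I_n -> 'I_n) (c : 'I_n) :
    rel ('I_n * 'I_n * 'Z_2) :=
  fun u v => let: (x, y, i) := u in
  [|| [exists z, (x != z) && (v == (z, y, i))],
      [exists z, (y != z) && (v == (x, z, i))],
      (i == 0%R) && [exists z, v == (mul x y, z, 1%R)],
      (i == 1%R) && [exists z, v == (z, mul y x, 0%R)],
      (i == 0%R) && [exists z, v == (mul c (mul x y), z, 1%R)] |
      (i == 1%R) && [exists z, v == (z, mul (mul y x) c, 0%R)]].

(* Main.v *)
Require Import Defs.
From HB Require Import structures.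
From mathcomp Require Import all_boot all_order all_algebra.
From mathcomp Require Import zify.

(** Applying the adjacency operator of [gamma3] to a function [G] only involves
    the sums of [G] over rows and columns of the two layers (and [G u]).  The
    row and column sums of [u |-> gamma3 u v] are explicit: within the layer of
    [v] they come from the rook graph, and across layers they equal 2 because
    translations of a quasigroup are bijective.  All degrees and numbers of
    2-paths follow; the undirected edges at [u] are the closed 2-paths. *)

Section Gamma3.

Variables (n : nat) (mul : 'I_n -> 'I_n -> 'I_n) (c : 'I_n).

Local Notation arc := (gamma3 mul c).
Local Notation layer0 := (0%R : 'Z_2).
Local Notation layer1 := (1%R : 'Z_2).

Local Arguments gamma3 : simpl never.

Lemma Z2_cases (P : 'Z_2 -> Prop) : P layer0 -> P layer1 -> forall i, P i.
Proof.
move=> P0 P1 [[|[|k]] lt_k2] //.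
- by have -> : Ordinal lt_k2 = layer0 by apply: val_inj.
- by have -> : Ordinal lt_k2 = layer1 by apply: val_inj.
Qed.

(** * The arc relation in coordinates *)

Lemma exists_row (a b s : 'I_n) (i j : 'Z_2) :
  [exists z, (a, b, i) == (s, z, j)] = (s == a) && (i == j).
Proof.
apply/existsP/andP => [[z /eqP[-> _ ->]]|[/eqP-> /eqP->]]; first by rewrite !eqxx.
by exists b.
Qed.

Lemma exists_column (a b s : 'I_n) (i j : 'Z_2) :
  [exists z, (a, b, i) == (z, s, j)] = (s == b) && (i == j).
Proof.
apply/existsP/andP => [[z /eqP[_ -> ->]]|[/eqP-> /eqP->]]; first by rewrite !eqxx.
by exists a.
Qed.

Lemma exists_row_neq (a b x y : 'I_n) (i j : 'Z_2) :
  [exists z, (y != z) && ((a, b, i) == (x, z, j))] =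
  [&& y != b, x == a & i == j].
Proof.
apply/existsP/and3P => [[z /andP[yz /eqP[-> -> ->]]]|[yb /eqP-> /eqP->]].
  by rewrite yz !eqxx.
by exists b; rewrite yb /=.
Qed.

Lemma exists_column_neq (a b x y : 'I_n) (i j : 'Z_2) :
  [exists z, (x != z) && ((a, b, i) == (z, y, j))] =
  [&& x != a, y == b & i == j].
Proof.
apply/existsP/and3P => [[z /andP[xz /eqP[-> -> ->]]]|[xa /eqP-> /eqP->]].
  by rewrite xz !eqxx.
by exists a; rewrite xa /=.
Qed.

Definition exists_vertexE :=
  (exists_row, exists_column, exists_row_neq, exists_column_neq).

(** Each layer is a rook graph: a dart changes exactly one of the two coordinates, hence the
    exclusive or. *)
Lemma gamma3_same_layer i x y a b :
  arc (x, y, i) (a, b, i) = (x == a) (+) (y == b).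
Proof.
rewrite /gamma3 !exists_vertexE.
by move: i; apply: Z2_cases; rewrite /= ?andbF ?andbT ?orbF;
  case: (x == a); case: (y == b).
Qed.

Lemma gamma3_01 x y a b :
  arc (x, y, layer0) (a, b, layer1) = (mul x y == a) || (mul c (mul x y) == a).
Proof. by rewrite /gamma3 !exists_vertexE /= ?andbF ?andbT ?orbF. Qed.

Lemma gamma3_10 x y a b :
  arc (x, y, layer1) (a, b, layer0) = (mul y x == b) || (mul (mul y x) c == b).
Proof. by rewrite /gamma3 !exists_vertexE /= ?andbF ?andbT ?orbF. Qed.

Hypothesis mulI : forall a, injective (mul a).
Hypothesis mulIr : forall a, injective (mul^~ a).
Hypothesis c_mul_neq : forall w, mul c w != w.
Hypothesis mul_c_neq : forall w, mul w c != w.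

(** * Sums over the vertices and the adjacency operator *)

Lemma sum_layers (F : 'I_n * 'I_n * 'Z_2 -> nat) :
  \sum_v F v = \sum_a \sum_b F (a, b, layer0) + \sum_a \sum_b F (a, b, layer1).
Proof.
transitivity (\sum_a \sum_b \sum_i F (a, b, i)).
  by rewrite !pair_bigA; apply: eq_bigr => -[[a b] i] _.
rewrite -big_split; apply: eq_bigr => a _; rewrite -big_split; apply: eq_bigr => b _.
rewrite !big_ord_recl big_ord0 addn0.
by congr (F (_, _) + F (_, _)); apply: val_inj.
Qed.

Lemma sum_delta (x : 'I_n) (G : 'I_n -> nat) : \sum_a (x == a) * G a = G x.
Proof.
rewrite (bigD1 x) //= eqxx mul1n big1 ?addn0 // => a ax.
by rewrite eq_sym (negbTE ax).
Qed.

(** An injective self-map of a finite set is bijective, so [b] has exactly one preimage. *)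
Lemma sum_inj_eq (h : 'I_n -> 'I_n) (b : 'I_n) :
  injective h -> \sum_x (h x == b) = 1.
Proof.
move=> h_inj; rewrite -[RHS](sum_delta b (fun=> 1)) [RHS](reindex_inj h_inj) /=.
by apply: eq_bigr => x _; rewrite muln1 eq_sym.
Qed.

Lemma sum_const (k : nat) : \sum_(a < n) k = n * k.
Proof. by rewrite sum_nat_const card_ord. Qed.

(** Row plus column counts the cell [(x, y)] twice, whereas the rook graph omits it. Pointwise this
    is p xor q + 2pq = p + q for bits p, q. The correction stays on the left to avoid truncated
    subtraction. *)
Lemma rook_operator x y (G : 'I_n -> 'I_n -> nat) :
  \sum_a \sum_b ((x == a) (+) (y == b)) * G a b + 2 * G x y =
  \sum_b G x b + \sum_a G a y.
Proof.
have -> : G x y = \sum_a \sum_b ((x == a) * ((y == b) * G a b)).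
  under eq_bigr => a _ do rewrite -big_distrr sum_delta.
  by rewrite sum_delta.
have -> : \sum_b G x b = \sum_a \sum_b (x == a) * G a b.
  under [RHS]eq_bigr => a _ do rewrite -big_distrr.
  by rewrite sum_delta.
have -> : \sum_a G a y = \sum_a \sum_b (y == b) * G a b.
  by apply: eq_bigr => a _; rewrite sum_delta.
rewrite big_distrr -!big_split; apply: eq_bigr => a _ /=.
rewrite big_distrr -!big_split; apply: eq_bigr => b _ /=.
by case: (x == a); case: (y == b) => /=; lia.
Qed.

(** Makes the cross-layer arc relation additive: the two targets, such as [mul x y] and
    [mul c (mul x y)], never coincide. *)
Lemma orb_add_neq (u w a : 'I_n) : w != u ->
  ((u == a) || (w == a) : nat) = (u == a) + (w == a).
Proof. by case: (eqVneq u a) => [->|] // /negbTE ->. Qed.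

(** The out-neighbours in the other layer fill two whole rows; from layer 1 they fill two whole
    columns instead. *)
Lemma arc_operator0 x y (G : 'I_n * 'I_n * 'Z_2 -> nat) :
  \sum_v arc (x, y, layer0) v * G v + 2 * G (x, y, layer0) =
  \sum_b G (x, b, layer0) + \sum_a G (a, y, layer0) +
  (\sum_b G (mul x y, b, layer1) + \sum_b G (mul c (mul x y), b, layer1)).
Proof.
(* The correction term is moved next to the layer 0 sum, to match the rook identity. *)
rewrite sum_layers addnAC -(rook_operator x y (fun a b => G (a, b, layer0))).
congr (_ + _ + _).
  by apply: eq_bigr => a _; apply: eq_bigr => b _; rewrite gamma3_same_layer.
under eq_bigr => a _ do under eq_bigr => b _ do
  rewrite gamma3_01 (orb_add_neq _ _ _ (c_mul_neq _)).
under eq_bigr => a _ do rewrite -big_distrr /= mulnDl.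
by rewrite big_split /= !sum_delta.
Qed.

Lemma arc_operator1 x y (G : 'I_n * 'I_n * 'Z_2 -> nat) :
  \sum_v arc (x, y, layer1) v * G v + 2 * G (x, y, layer1) =
  \sum_b G (x, b, layer1) + \sum_a G (a, y, layer1) +
  (\sum_a G (a, mul y x, layer0) + \sum_a G (a, mul (mul y x) c, layer0)).
Proof.
rewrite sum_layers -addnA addnC -(rook_operator x y (fun a b => G (a, b, layer1))).
congr (_ + _ + _).
  by apply: eq_bigr => a _; apply: eq_bigr => b _; rewrite gamma3_same_layer.
under eq_bigr => a _ do under eq_bigr => b _ do
  rewrite gamma3_10 (orb_add_neq _ _ _ (mul_c_neq _)) mulnDl.
rewrite -big_split; apply: eq_bigr => a _.
by rewrite big_split /= !sum_delta.
Qed.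

(** * Row and column sums of the arc relation *)

Lemma xor_sum (z : bool) (s : 'I_n) :
  \sum_a (z (+) (a == s)) + 2 * z = n * z + 1.
Proof.
have S : \sum_(a < n) (a == s) = 1 by apply: (sum_inj_eq id) => ? ?.
case: z; last by rewrite [X in X + _]S; lia.
(* Here the exclusive or is negation, so complementary indicators add up to [n]. *)
suff : \sum_a (true (+) (a == s)) + \sum_(a < n) (a == s) = n * 1 by rewrite S; lia.
rewrite -sum_const -big_split; apply: eq_bigr => a _.
by case: (a == s).
Qed.

Lemma row_sum_same i x p q :
  \sum_b arc (x, b, i) (p, q, i) + 2 * (x == p) = n * (x == p) + 1.
Proof.
rewrite -(xor_sum _ q); congr (_ + _).
by apply: eq_bigr => b _; rewrite gamma3_same_layer.
Qed.

Lemma column_sum_same i y p q :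
  \sum_a arc (a, y, i) (p, q, i) + 2 * (y == q) = n * (y == q) + 1.
Proof.
rewrite -(xor_sum _ p); congr (_ + _).
by apply: eq_bigr => a _; rewrite gamma3_same_layer addbC.
Qed.

(** Each of the equations xb = p and c(xb) = p has one solution b, since left translations are
    bijective. The next three sums use other translations in the same way. *)
Lemma row_sum_01 x p q : \sum_b arc (x, b, layer0) (p, q, layer1) = 2.
Proof.
under eq_bigr => b _ do rewrite gamma3_01 (orb_add_neq _ _ _ (c_mul_neq _)).
rewrite big_split (sum_inj_eq (mul x)) // (sum_inj_eq (mul c \o mul x)) //.
exact: inj_comp.
Qed.

Lemma column_sum_01 y p q : \sum_a arc (a, y, layer0) (p, q, layer1) = 2.
Proof.
under eq_bigr => a _ do rewrite gamma3_01 (orb_add_neq _ _ _ (c_mul_neq _)).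
rewrite big_split (sum_inj_eq (mul^~ y)) // (sum_inj_eq (mul c \o mul^~ y)) //.
exact: inj_comp.
Qed.

Lemma row_sum_10 x p q : \sum_b arc (x, b, layer1) (p, q, layer0) = 2.
Proof.
under eq_bigr => b _ do rewrite gamma3_10 (orb_add_neq _ _ _ (mul_c_neq _)).
rewrite big_split (sum_inj_eq (mul^~ x)) // (sum_inj_eq (mul^~ c \o mul^~ x)) //.
exact: inj_comp.
Qed.

Lemma column_sum_10 y p q : \sum_a arc (a, y, layer1) (p, q, layer0) = 2.
Proof.
under eq_bigr => a _ do rewrite gamma3_10 (orb_add_neq _ _ _ (mul_c_neq _)).
rewrite big_split (sum_inj_eq (mul y)) // (sum_inj_eq (mul^~ c \o mul y)) //.
exact: inj_comp.
Qed.

(** * Degrees and 2-paths *)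

Lemma gamma3_outdeg u : \sum_v arc u v = 4 * n - 2.
Proof.
case: u => -[x y]; apply: Z2_cases.
  have := arc_operator0 x y (fun=> 1); under eq_bigr => v _ do rewrite muln1.
  by rewrite !sum_const; lia.
have := arc_operator1 x y (fun=> 1); under eq_bigr => v _ do rewrite muln1.
by rewrite !sum_const; lia.
Qed.

(** The layer of [v] contributes 2n - 2, and each of the [n] rows of the other layer contributes
    2. *)
Lemma gamma3_indeg v : \sum_u arc u v = 4 * n - 2.
Proof.
have rows p q i :
    \sum_a \sum_b arc (a, b, i) (p, q, i) + 2 = n + n.
  have S : \sum_(a < n) (a == p) = 1 by apply: (sum_inj_eq id) => ? ?.
  have : \sum_a (\sum_b arc (a, b, i) (p, q, i) + 2 * (a == p)) =
      \sum_a (n * (a == p) + 1) by apply: eq_bigr => a _; exact: row_sum_same.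
  rewrite big_split -big_distrr S [X in _ = X -> _]big_split -big_distrr S (sum_const 1) /=; lia.
case: v => -[p q]; apply: Z2_cases; rewrite sum_layers.
  under [X in _ + X = _]eq_bigr => a _ do rewrite row_sum_10.
  by have := rows p q layer0; rewrite sum_const; lia.
under eq_bigr => a _ do rewrite row_sum_01.
by have := rows p q layer1; rewrite sum_const; lia.
Qed.

(** The operator is applied to [arc^~ w]. Of the four row or column sums it yields, two run across
    layers and give 4 in total; each of the other two is n - 1 if its line passes through [w] and 1
    otherwise. Finally 2 is subtracted if there is an arc from [u] to [w]. *)
Lemma gamma3_paths2 u w :
  \sum_v arc u v * arc v w =
  if u == w then 2 * n + 2 else if arc u w then n + 2 else 6.
Proof.
have n_gt0 : 0 < n by case: u => -[[]]; lia.
case: u w => -[x y] + [[p q]]; apply: Z2_cases; apply: Z2_cases; rewrite !xpair_eqE.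
- have := arc_operator0 x y (fun v => arc v (p, q, layer0)).
  rewrite /= !row_sum_10 gamma3_same_layer.
  have := row_sum_same layer0 x p q; have := column_sum_same layer0 y p q.
  by case: (x == p); case: (y == q) => /=; lia.
- have := arc_operator0 x y (fun v => arc v (p, q, layer1)).
  rewrite /= row_sum_01 column_sum_01 gamma3_01 andbF.
  have := row_sum_same layer1 (mul x y) p q.
  have := row_sum_same layer1 (mul c (mul x y)) p q.
  (* At most one of the two target rows is the row of [w], so the count is n + 2 or 6 and never
     larger. *)
  case: (eqVneq (mul x y) p) => [<-|_]; first by rewrite (negbTE (c_mul_neq _)) /=; lia.
  by case: (_ == p) => /=; lia.
- have := arc_operator1 x y (fun v => arc v (p, q, layer0)).
  rewrite /= row_sum_10 column_sum_10 gamma3_10 andbF.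
  have := column_sum_same layer0 (mul y x) p q.
  have := column_sum_same layer0 (mul (mul y x) c) p q.
  case: (eqVneq (mul y x) q) => [<-|_]; first by rewrite (negbTE (mul_c_neq _)) /=; lia.
  by case: (_ == q) => /=; lia.
- have := arc_operator1 x y (fun v => arc v (p, q, layer1)).
  rewrite /= !column_sum_01 gamma3_same_layer.
  have := row_sum_same layer1 x p q; have := column_sum_same layer1 y p q.
  by case: (x == p); case: (y == q) => /=; lia.
Qed.

End Gamma3.

(** * From sums to cardinalities, and from the loop axioms to cancellation *)

Lemma card_set_sum (T : finType) (P : pred T) : #|[set x | P x]| = \sum_x P x.
Proof. by rewrite cardsE -sum1_card big_mkcond. Qed.

Theorem theorem4p3 (n : nat) (mul : 'I_n -> 'I_n -> 'I_n) (e c : 'I_n)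
    (hL : loop mul e) (hc : c <> e) :
  dsrg (gamma3 mul c) (2 * n ^ 2) (4 * n - 2) (2 * n + 2) (n + 2) 6.
Proof.
have [quasi unit_e] := hL.
have mulI a : injective (mul a).
  by move=> x y Exy; have [[z [_ uz]] _] := quasi a (mul a y); rewrite -(uz x Exy) (uz y).
have mulIr a : injective (mul^~ a).
  move=> x y /= Exy; have [_ [z [_ uz]]] := quasi a (mul y a).
  by rewrite -(uz x Exy) (uz y).
(* From cw = w = ew, cancelling w would give c = e; the mirror argument follows. *)
have c_mul_neq w : mul c w != w.
  by apply/eqP => Ew; apply: hc; apply: (mulIr w); rewrite /= Ew (unit_e w).1.
have mul_c_neq w : mul w c != w.
  by apply/eqP => Ew; apply: hc; apply: (mulI w); rewrite Ew (unit_e w).2.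
have paths := gamma3_paths2 _ _ _ mulI mulIr c_mul_neq mul_c_neq.
split.
- by rewrite !card_prod !card_ord mulnn mulnC.
- by move=> [[x y] i]; rewrite gamma3_same_layer !eqxx.
- by move=> u; rewrite card_set_sum gamma3_outdeg.
- by move=> u; rewrite card_set_sum gamma3_indeg.
- move=> u; rewrite card_set_sum; have := paths u u; rewrite eqxx => <-.
  by apply: eq_bigr => v _; rewrite mulnb.
- move=> u w uw; rewrite card_set_sum; have := paths u w; rewrite (negbTE uw) => <-.
  by apply: eq_bigr => v _; rewrite mulnb.
Qed.
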